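(* Let $\mathbb{F}_q$ be the finite field with $q$ elements (regarded as an additive group). Then $$\mathrm{Conj}_{\mathbb{F}_q \wr \mathbb{Z}}(n) \approx 2^n.$$
   Context: $A \wr B = \left(\bigoplus_{b \in B} A\right) \rtimes B$ is the restricted wreath product, with $B$ acting by translation of the coordinates. Let $G$ be a finitely generated group with finite generating set $S$; $\mathrm{B}_{G,S}(n)$ is the ball of radius $n$ around the identity in the word length of $S$. Write $\sim_G$ for conjugacy in $G$. For $f \not\sim_G g$ put $\mathrm{CD}_G(f,g) = \min\{|G/N| : N \trianglelefteq G \text{ of finite index and } fN \not\sim_{G/N} gN\}$, with value $\infty$ if no such $N$ exists. $G$ is conjugacy separable if $\mathrm{CD}_G(f,g)<\infty$ for all non-conjugate $f,g\in G$. For conjugacy separable $G$, the conjugacy separability depth function is $\mathrm{Conj}_{G,S}(n) = \max\{\mathrm{CD}_G(f,g) : f,g \in \mathrm{B}_{G,S}(n),\ f \not\sim_G g\}$. For non-decreasing functions $f,g$ on $\mathbb{N}$, write $f \preceq g$ if there is $C \in \mathbb{N}$ with $f(n) \leq C g(Cn)$ for all $n \in \mathbb{N}$, and $f \approx g$ if $f \preceq g$ and $g \preceq f$. Up to $\approx$, $\mathrm{Conj}_{G,S}$ does not depend on the finite generating set $S$, so $S$ is suppressed. *)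

(* Defs.v *)
From HB Require Import structures.
From mathcomp Require Import all_boot all_order all_algebra.
From mathcomp Require Import finmap generic_quotient.
From mathcomp Require Import boolp classical_sets cardinality.

Set Implicit Arguments.
Unset Strict Implicit.
Unset Printing Implicit Defensive.

Local Open Scope classical_set_scope.
Local Open Scope quotient_scope.
Local Open Scope group_scope.

(* The group law of [Algebra.to_multiplicative V] is the addition of V.       *)

Section WreathProduct.
Variables A B : groupType.

(* A pair (f, b) stands for f * b, with f in the restricted direct power and  *)
(* b acting on f by (b . f) x = f (b^-1 * x).                                 *)
Definition wreath : Type := ({fsfun B -> A with 1} * B)%type.

HB.instance Definition _ := Choice.on wreath.

Implicit Types u v w : wreath.

Definition wr_one : wreath := ([fsfun of _ => 1], 1).

Definition wr_mul u v : wreath :=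
  ([fsfun x in finsupp u.1 `|` [fset u.2 * y | y in finsupp v.1] =>
      u.1 x * v.1 (u.2^-1 * x)]%fset, u.2 * v.2).

Definition wr_inv u : wreath :=
  ([fsfun x in [fset u.2^-1 * y | y in finsupp u.1] =>
      (u.1 (u.2 * x))^-1]%fset, u.2^-1).

Lemma wr_mulE u v x : (wr_mul u v).1 x = u.1 x * v.1 (u.2^-1 * x).
Proof.
rewrite fsfun_fun; case: ifPn => //; rewrite in_fsetU negb_or => /andP[ux vx].
rewrite (fsfun_dflt ux) mul1g fsfun_dflt//; apply: contra vx => vx.
by apply/imfsetP; exists (u.2^-1 * x); rewrite ?mulVKg.
Qed.

Lemma wr_invE u x : (wr_inv u).1 x = (u.1 (u.2 * x))^-1.
Proof.
rewrite fsfun_fun; case: ifPn => // ux.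
rewrite fsfun_dflt ?invg1//; apply: contra ux => ux.
by apply/imfsetP; exists (u.2 * x); rewrite ?mulKg.
Qed.

Lemma wr_ext u v : u.1 =1 v.1 -> u.2 = v.2 -> u = v.
Proof. by case: u v => [f b] [g c] /= /fsfunP -> ->. Qed.

Lemma wr_mulA : associative wr_mul.
Proof.
move=> u v w; apply: wr_ext => [x|]; last exact: mulgA.
by rewrite !wr_mulE invgM !mulgA.
Qed.

Lemma wr_mul1 : left_id wr_one wr_mul.
Proof.
move=> u; apply: wr_ext => [x|]; last exact: mul1g.
by rewrite wr_mulE fsfun0E mul1g invg1 mul1g.
Qed.

Lemma wr_mulr1 : right_id wr_one wr_mul.
Proof.
move=> u; apply: wr_ext => [x|]; last exact: mulg1.
by rewrite wr_mulE fsfun0E mulg1.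
Qed.

Lemma wr_mulV : left_inverse wr_one wr_inv wr_mul.
Proof.
move=> u; apply: wr_ext => [x|]; last exact: mulVg.
by rewrite wr_mulE wr_invE fsfun0E invgK mulVg.
Qed.

Lemma wr_mulrV : right_inverse wr_one wr_inv wr_mul.
Proof.
move=> u; apply: wr_ext => [x|]; last exact: mulgV.
by rewrite wr_mulE wr_invE fsfun0E mulVKg mulgV.
Qed.

HB.instance Definition _ :=
  isGroup.Build wreath wr_mulA wr_mul1 wr_mulr1 wr_mulV wr_mulrV.

End WreathProduct.

Record normalSubgroup (G : groupType) := NormalSubgroup {
  nsub_set :> G -> Prop;
  nsub1 : nsub_set 1;
  nsubM : forall x y, nsub_set x -> nsub_set y -> nsub_set (x * y);
  nsubV : forall x, nsub_set x -> nsub_set x^-1;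
  nsubJ : forall x y, nsub_set x -> nsub_set (x ^ y)
}.

Section QuotientGroup.
Variables (G : groupType) (N : normalSubgroup G).

Definition coset_rel : rel G := fun x y => `[< N (x^-1 * y) >].

Lemma coset_relP x y : reflect (N (x^-1 * y)) (coset_rel x y).
Proof. exact: asboolP. Qed.

Lemma coset_rel_equiv : equiv_class_of coset_rel.
Proof.
have sym x y : coset_rel x y -> coset_rel y x.
  move=> /coset_relP /nsubV; rewrite invgM invgK => ?; exact/coset_relP.
split=> [x|x y|y x z].
- by apply/coset_relP; rewrite mulVg; exact: nsub1.
- by apply/idP/idP; exact: sym.
- move=> /coset_relP xy /coset_relP yz; apply/coset_relP.
  by move: (nsubM xy yz); rewrite mulgA mulgK.
Qed.

Canonical coset_rel_equivRel := EquivRelPack coset_rel_equiv.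

Definition quotient_group : Type := {eq_quot coset_rel}.

HB.instance Definition _ := Choice.on quotient_group.
HB.instance Definition _ := EqQuotient.on quotient_group.

Implicit Types a b c : quotient_group.

Definition quo_proj (x : G) : quotient_group := \pi_quotient_group x.

Lemma quo_reprK a : quo_proj (repr a) = a.
Proof. exact: reprK. Qed.

Lemma quo_ind (P : quotient_group -> Prop) :
  (forall x, P (quo_proj x)) -> forall a, P a.
Proof. by move=> Px a; rewrite -(quo_reprK a). Qed.

Lemma quo_eqP (x y : G) :
  reflect (N (x^-1 * y)) (quo_proj x == quo_proj y).
Proof. by rewrite /quo_proj piE; exact: coset_relP. Qed.

Definition quo_one : quotient_group := quo_proj 1.
Definition quo_mul a b : quotient_group := quo_proj (repr a * repr b).
Definition quo_inv a : quotient_group := quo_proj (repr a)^-1.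

Lemma quo_reprE (x : G) : N (x^-1 * repr (quo_proj x)).
Proof. by apply/quo_eqP; rewrite quo_reprK. Qed.

Lemma quo_mulE (x y : G) :
  quo_mul (quo_proj x) (quo_proj y) = quo_proj (x * y).
Proof.
apply/esym/eqP/quo_eqP; set x' := repr _; set y' := repr _.
have -> : (x * y)^-1 * (x' * y') = (x^-1 * x') ^ y * (y^-1 * y').
  by rewrite /conjg invgM !mulgA mulgK.
by apply: nsubM; [apply: nsubJ|]; exact: quo_reprE.
Qed.

Lemma quo_invE (x : G) : quo_inv (quo_proj x) = quo_proj x^-1.
Proof.
apply/eqP/quo_eqP; rewrite invgK; set x' := repr _.
have -> : x' * x^-1 = (x^-1 * x') ^ x^-1.
  by rewrite /conjg invgK !mulgA mulgV mul1g.
by apply: nsubJ; exact: quo_reprE.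
Qed.

Lemma quo_mulA : associative quo_mul.
Proof.
by elim/quo_ind=> x; elim/quo_ind=> y; elim/quo_ind=> z; rewrite !quo_mulE mulgA.
Qed.

Lemma quo_mul1 : left_id quo_one quo_mul.
Proof. by elim/quo_ind=> x; rewrite quo_mulE mul1g. Qed.

Lemma quo_mulr1 : right_id quo_one quo_mul.
Proof. by elim/quo_ind=> x; rewrite quo_mulE mulg1. Qed.

Lemma quo_mulV : left_inverse quo_one quo_inv quo_mul.
Proof. by elim/quo_ind=> x; rewrite quo_invE quo_mulE mulVg. Qed.

Lemma quo_mulrV : right_inverse quo_one quo_inv quo_mul.
Proof. by elim/quo_ind=> x; rewrite quo_invE quo_mulE mulgV. Qed.

HB.instance Definition _ :=
  isGroup.Build quotient_group quo_mulA quo_mul1 quo_mulr1 quo_mulV quo_mulrV.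

Lemma quo_projM x y : quo_proj (x * y) = quo_proj x * quo_proj y.
Proof. by symmetry; exact: quo_mulE. Qed.

Lemma quo_projP x y : quo_proj x = quo_proj y <-> N (x^-1 * y).
Proof. by split=> [/eqP/quo_eqP|/quo_eqP/eqP]. Qed.

End QuotientGroup.

Definition conjugate (G : groupType) (x y : G) : Prop := exists z, y = x ^ z.

Section ConjugacySeparability.
Variable G : groupType.
Implicit Types (f g x : G) (S : {fset G}) (N : normalSubgroup G).

Definition finite_index N : Prop := finite_set [set: quotient_group N].

(* The order of G / N, meaningful when N has finite index. *)
Definition quotient_order N : nat := #|` fset_set [set: quotient_group N]|.

Definition separates N f g : Prop :=
  ~ conjugate (quo_proj N f) (quo_proj N g).

Definition separating_orders f g : set nat :=
  [set m | exists N, [/\ finite_index N, separates N f g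
      & quotient_order N = m]].

(* [None] is the value infinity. *)
Definition CD f g : option nat :=
  if pselect (exists m, `[< separating_orders f g m >]) is left ex
  then Some (ex_minn ex) else None.

Definition conjugacy_separable : Prop :=
  forall f g, ~ conjugate f g -> CD f g <> None.

Definition ball S (n : nat) : set G :=
  [set x | exists w : seq G,
    [/\ (size w <= n)%N, all (fun s => (s \in S) || (s^-1 \in S)) w
      & x = \prod_(s <- w) s]].

Definition generates S : Prop := forall x, exists n, ball S n x.

Definition finitely_generated : Prop := exists S, generates S.

Lemma finite_ball S n : finite_set (ball S n).
Proof.
pose L := (S `|` [fset s^-1 | s in S])%fset.
elim: n => [|n IHn].
  apply: (@sub_finite_set _ _ [set 1]); last exact: finite_set1.
  by move=> x [[|s w] []] // _ _ ->; rewrite big_nil.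
apply: (@sub_finite_set _ _
    ([set 1] `|` [set s * y | s in [set` L] & y in ball S n])); last first.
  rewrite finite_setU; split; first exact: finite_set1.
  exact: finite_image2.
move=> x [[|s w] [/= wn]]; first by move=> _ ->; left; rewrite big_nil.
move=> /andP[sS wS] ->; right; exists s.
  rewrite /= in_fsetU; case/orP: sS => [->//|sS]; apply/orP; right.
  by apply/imfsetP; exists s^-1; rewrite ?invgK.
by exists (\prod_(t <- w) t); [exists w|rewrite big_cons].
Qed.

Definition nonconjugate_pairs S n : set (G * G) :=
  [set p | [/\ ball S n p.1, ball S n p.2 & ~ conjugate p.1 p.2] ].

Lemma finite_nonconjugate_pairs S n : finite_set (nonconjugate_pairs S n).
Proof.
apply: (@sub_finite_set _ _ (ball S n `*` ball S n)); first by move=> p [].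
by apply: finite_setX; exact: finite_ball.
Qed.

(* The set of pairs is finite, so [fset_set] merely enumerates it; an empty   *)
(* maximum is 0.  The default of [odflt] is never used when G is conjugacy    *)
(* separable.                                                                 *)
Definition Conj S (n : nat) : nat :=
  \max_(p <- fset_set (nonconjugate_pairs S n)) odflt 0%N (CD p.1 p.2).

End ConjugacySeparability.

(* Growth functions have domain {1, 2, ...}. In particular Conj 0 = 0, a      *)
(* maximum over the empty set, plays no role.                                 *)
Definition preceq (f g : nat -> nat) : Prop :=
  exists2 C, (0 < C)%N & forall n, (0 < n)%N -> (f n <= C * g (C * n))%N.

Definition growth_equiv (f g : nat -> nat) : Prop := preceq f g /\ preceq g f.

(* Main.v *)
Require Import Defs.
From mathcomp Require Import all_boot all_order all_algebra.
From mathcomp Require Import finmap.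
From mathcomp Require Import boolp classical_sets cardinality.
From mathcomp Require Import finfield zify ring.

(* Write t for the generator of Z, acting as X on the Laurent polynomials     *)
(* V[X, 1/X], so that conjugating f t^b gives X^s (f + (X^b - 1) h) t^b.      *)
(*                                                                            *)
(* Upper bound: two elements of the n-ball which are not conjugate remain so  *)
(* in V wr (Z/m) for some m linear in n: m = |b| if both have the same        *)
(* nonzero shift b, because conjugacy then only depends on classes modulo     *)
(* X^b - 1; otherwise any m exceeding the diameter of the supports works.     *)
(*                                                                            *)
(* Lower bound: take b = p^k, so that X^b - 1 = (X - 1)^b, and the elements   *)
(* t^b and (a t)^b = (1 + ... + X^(b-1)) t^b = (X - 1)^(b-1) t^b. If N        *)
(* separates them, then (X - 1)^(b-1) is not in the submodule I = (N meet     *)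
(* V[X, 1/X]) + (X^b - 1). But, modulo I and up to sign, (X - 1)^(b-1) is     *)
(* obtained from any nontrivial combination of the (X - 1)^i, i < b, with     *)
(* coefficients in {-1, 0, 1} by multiplying with a power of X - 1; hence the *)
(* 2^b subset sums of these powers are distinct modulo N.                     *)

Set Implicit Arguments.
Unset Strict Implicit.
Unset Printing Implicit Defensive.

Import Order.TTheory GRing.Theory Num.Theory.

Local Open Scope ring_scope.

(** Both bounds are congruences between Laurent polynomials. The kernel of reduction to V wr (Z/m)
    has index at most |V|^m m ([residue_kernel_order]), and [separates_residue_kernel] finds a
    separating m linear in the word length; hence [Conj_upper]. Conversely, by
    [quotient_order_trace_ideal], a finite quotient separating t^b from (a t)^b, b a power of p, has
    order at least 2^b. These two elements have length linear in b, and some power of p lies between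
    n and p n, so [Conj_lower] holds for every n. *)

Local Notation lamp V :=
  (wreath (Algebra.to_multiplicative V) (Algebra.to_multiplicative int)).

(** * Coordinates on the wreath product and partial sums of configurations *)

Section Coordinates.
Variable V : zmodType.
Implicit Types (u v z : lamp V) (x y r : int) (P Q : pred int).

Definition config u x : V := u.1 x.
Definition shift u : int := u.2.

Lemma lampP u v : config u =1 config v -> shift u = shift v -> u = v.
Proof. by move=> uv b_uv; apply: wr_ext => // x; exact: uv. Qed.

Lemma configM u v x : config (u * v)%g x = config u x + config v (x - shift u).
Proof. by rewrite [x - _]addrC; exact: (wr_mulE u v x). Qed.

Lemma shiftM u v : shift (u * v)%g = shift u + shift v.
Proof. by []. Qed.

Lemma configV u x : config u^-1%g x = - config u (x + shift u).
Proof. by rewrite [x + _]addrC; exact: (wr_invE u x). Qed.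

Lemma shiftV u : shift u^-1%g = - shift u.
Proof. by []. Qed.

Lemma config1 x : config 1%g x = 0.
Proof. by rewrite /config fsfun0E. Qed.

Lemma configJ u z x : config (u ^ z)%g x =
  config u (x + shift z) +
  (config z (x + shift z - shift u) - config z (x + shift z)).
Proof.
rewrite /conjg configM configM configV shiftV opprK [LHS]addrC -addrA.
by [].
Qed.

Lemma shiftJ u z : shift (u ^ z)%g = shift u.
Proof. by rewrite /conjg !shiftM shiftV addrCA addNr addr0. Qed.

Definition mklamp (D : {fset int}) (f : int -> V) (b : int) : lamp V :=
  ([fsfun x in D => f x : Algebra.to_multiplicative V], b).

Lemma config_mklamp D f b x :
  config (mklamp D f b) x = if x \in D then f x else 0.
Proof. by rewrite /config fsfun_fun. Qed.

Lemma shift_mklamp D f b : shift (mklamp D f b) = b.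
Proof. by []. Qed.

Definition supp u : {fset int} := finsupp u.1.

Lemma mem_supp u x : (x \in supp u) = (config u x != 0).
Proof. exact: mem_finsupp. Qed.

(** The predicate is arbitrary so that full residue classes and their upper halves are both
    covered. *)
Definition csum (P : pred int) u : V := \sum_(y <- supp u | P y) config u y.

Lemma csumE (D : {fset int}) P u :
  {subset supp u <= D} -> csum P u = \sum_(y <- D | P y) config u y.
Proof.
move=> sD; rewrite /csum big_mkcond [RHS]big_mkcond.
apply: big_fset_incl; first exact/fsubsetP.
by move=> x _; rewrite mem_supp negbK => /eqP ->; case: (P x).
Qed.

Lemma eq_csum P Q u : P =1 Q -> csum P u = csum Q u.
Proof. by move=> PQ; apply: eq_bigl. Qed.

Lemma csumM P u v :
  csum P (u * v)%g = csum P u + csum (fun y => P (y + shift u)) v.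
Proof.
pose T := [fset (y + shift u)%R | y in supp v]%fset.
pose D := (supp u `|` T)%fset.
have sT y : (y \in T) = (y - shift u \in supp v).
  apply/imfsetP/idP => /= [[a av ->]|yv]; first by rewrite addrK.
  by exists (y - shift u); rewrite ?subrK.
have suD : {subset supp u <= D} by apply/fsubsetP/fsubsetUl.
rewrite (csumE (D := D)); last first.
  move=> y; rewrite in_fsetU sT !mem_supp configM -negb_and.
  by apply: contra => /andP[/eqP -> /eqP ->]; rewrite addr0.
rewrite (eq_bigr _ (fun y _ => configM u v y)) big_split /= -csumE //.
congr (_ + _); rewrite big_mkcond -(@big_fset_incl _ _ _ _ T) /=; first last.
- move=> y _; rewrite sT mem_supp negbK => /eqP ->; exact: if_same.
- exact: fsubsetUr.
rewrite big_imfset /=; last by move=> a c _ _ /addIr.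
by rewrite [RHS]big_mkcond; apply: eq_bigr => y _; rewrite addrK.
Qed.

Lemma csum1 P : csum P 1%g = 0.
Proof. by rewrite /csum big1 // => y _; rewrite config1. Qed.

Lemma csum_eq0 P u : (forall y, P y -> config u y = 0) -> csum P u = 0.
Proof. by move=> uP; rewrite /csum big1. Qed.

Lemma csum_single P u r :
  P r -> (forall y, config u y != 0 -> P y -> y = r) -> csum P u = config u r.
Proof.
move=> Pr uP; rewrite (csumE (D := (r |` supp u)%fset)); last first.
  by apply/fsubsetP/fsubsetUr.
rewrite big_mkcond (big_fsetD1 r) ?fset1U1 //= Pr big1_fset ?addr0 // => y.
rewrite !inE => /andP[yr _] _; case: ifP => // Py.
by apply/eqP; apply: contraNT yr => /uP /(_ Py) ->.
Qed.

End Coordinates.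

(** * Conjugacy in quotients and bounds on their orders *)

Section Quotients.
Variables (G : groupType) (N : normalSubgroup G).
Implicit Types x y : G.

Lemma quo_projJ x y :
  quo_proj N (x ^ y)%g = (quo_proj N x ^ quo_proj N y)%g.
Proof.
rewrite /conjg !quo_projM; congr (_ * _)%g.
by symmetry; exact: quo_invE.
Qed.

Lemma quo_conjP x y :
  conjugate (quo_proj N x) (quo_proj N y) <->
  exists z, N ((x ^ z)^-1 * y)%g.
Proof.
split=> -[z]; last first.
  by move=> /quo_projP xy; exists (quo_proj N z); rewrite -quo_projJ xy.
rewrite -(quo_reprK z) -quo_projJ => xy.
by exists (repr z); apply/quo_projP.
Qed.

(** Evaluating f on coset representatives embeds G / N in T; f need not be a homomorphism. *)
Lemma quotient_order_le (T : finType) (f : G -> T) :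
  (forall x y, f x = f y -> N (x^-1 * y)%g) ->
  finite_index N /\ (quotient_order N <= #|T|)%N.
Proof.
move=> fN; pose g (a : quotient_group N) := f (repr a).
have g_inj : injective g.
  by move=> a b /fN /quo_projP; rewrite !quo_reprK.
have fin : finite_index N.
  by apply: (@finite_preimage _ _ setT%classic g _ finite_finset); exact: in2W.
split=> //; rewrite /quotient_order.
rewrite -(size_map g) -(card_uniqP _) ?max_card //.
by rewrite map_inj_uniq ?fset_uniq.
Qed.

Lemma quotient_order_ge (T : finType) (f : T -> G) :
  (forall i j, N ((f i)^-1 * f j)%g -> i = j) ->
  finite_index N -> (#|T| <= quotient_order N)%N.
Proof.
move=> fN fin; rewrite /quotient_order cardE -(size_map (quo_proj N \o f)).
apply: uniq_leq_size.
  by rewrite map_inj_uniq ?enum_uniq // => i j /= /quo_projP /fN.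
by move=> a _; rewrite in_fset_set // in_setT.
Qed.

Lemma separates_finite_CD x y : finite_index N -> separates N x y ->
  exists2 k, CD x y = Some k & (k <= quotient_order N)%N.
Proof.
move=> fin sep; have so : separating_orders x y (quotient_order N).
  by exists N.
rewrite /CD; case: pselect => [ex|[]]; last first.
  by exists (quotient_order N); apply/asboolP.
by case: ex_minnP => k _ kmin; exists k => //; apply/kmin/asboolP.
Qed.

End Quotients.

Lemma dvdz_small (m : nat) (d : int) :
  (m%:Z %| d)%Z -> (`|d| < m)%N -> d = 0.
Proof.
move=> md dm; apply/eqP; rewrite -absz_eq0; apply: contraTT md => d0.
by rewrite dvdzE gtnNdvd ?lt0n.
Qed.

(** * Reduction of positions modulo m *)

Section ResidueSums.
Variables (V : zmodType) (m : nat).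
Implicit Types (u v z : lamp V) (x y r s : int).

(** This is the coordinate at the class of r of the image of u in V wr (Z/m). *)
Definition rsum u r : V := csum (fun y => (m%:Z %| y - r)%Z) u.

Lemma rsum_congr u r s : (m%:Z %| r - s)%Z -> rsum u r = rsum u s.
Proof.
move=> rs; apply: eq_csum => y.
have -> : y - s = (y - r) + (r - s) by rewrite addrA subrK.
by rewrite [RHS]rpredDr.
Qed.

Lemma rsumM u v r : rsum (u * v)%g r = rsum u r + rsum v (r - shift u).
Proof.
rewrite /rsum csumM; congr (_ + _); apply: eq_csum => y.
by rewrite opprB addrA addrAC.
Qed.

Lemma rsum1 r : rsum 1%g r = 0.
Proof. exact: csum1. Qed.

Lemma rsumV u r : rsum u^-1%g r = - rsum u (r + shift u).
Proof.
by apply/eqP; rewrite -addr_eq0 -[shift u]opprK -shiftV -rsumM mulVg rsum1.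
Qed.

Lemma rsumJ u z r : rsum (u ^ z)%g r = rsum u (r + shift z) +
  (rsum z (r + shift z - shift u) - rsum z (r + shift z)).
Proof.
by rewrite /conjg rsumM rsumM rsumV shiftV opprK [LHS]addrC -addrA.
Qed.

Lemma rsumJ_dvd u z r : (m%:Z %| shift u)%Z ->
  rsum (u ^ z)%g r = rsum u (r + shift z).
Proof.
move=> mu; rewrite rsumJ [X in X - _](@rsum_congr _ _ (r + shift z)).
  by rewrite subrr addr0.
by rewrite addrC addKr rpredN.
Qed.

Definition residue_kernel_set u : Prop :=
  (m%:Z %| shift u)%Z /\ forall r, rsum u r = 0.

Lemma residue_kernel1 : residue_kernel_set 1%g.
Proof. by split=> [|r]; [exact: dvdz0 | exact: rsum1]. Qed.

Lemma residue_kernelM u v : residue_kernel_set u -> residue_kernel_set v ->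
  residue_kernel_set (u * v)%g.
Proof.
move=> [mu ru] [mv rv]; split=> [|r]; first by rewrite shiftM rpredD.
by rewrite rsumM ru rv addr0.
Qed.

Lemma residue_kernelV u : residue_kernel_set u -> residue_kernel_set u^-1%g.
Proof.
move=> [mu ru]; split=> [|r]; first by rewrite shiftV rpredN.
by rewrite rsumV ru oppr0.
Qed.

Lemma residue_kernelJ u z :
  residue_kernel_set u -> residue_kernel_set (u ^ z)%g.
Proof.
move=> [mu ru]; split=> [|r]; first by rewrite shiftJ.
by rewrite rsumJ_dvd.
Qed.

(** The kernel of the projection onto V wr (Z/m). *)
Definition residue_kernel : normalSubgroup (lamp V) :=
  NormalSubgroup residue_kernel1 residue_kernelM residue_kernelV
    residue_kernelJ.

Lemma residue_kernelP u v : residue_kernel (u^-1 * v)%g <->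
  (m%:Z %| shift v - shift u)%Z /\ rsum u =1 rsum v.
Proof.
rewrite /= /residue_kernel_set shiftM shiftV addrC.
split=> -[mvu uv]; split=> // r.
  have := uv (r - shift u); rewrite rsumM rsumV shiftV opprK subrK.
  by move/eqP; rewrite addrC subr_eq0 => /eqP ->.
by rewrite rsumM rsumV shiftV opprK uv addNr.
Qed.

End ResidueSums.

(** A coset is determined by its m residue sums and its shift modulo m. *)
Lemma residue_kernel_order (V : finZmodType) (m : nat) : (0 < m)%N ->
  finite_index (residue_kernel V m) /\
  (quotient_order (residue_kernel V m) <= #|V| ^ m * m)%N.
Proof.
case: m => // m _; set M := m.+1.
pose f (u : lamp V) : {ffun 'I_M -> V} * 'I_M :=
  ([ffun i : 'I_M => rsum M u i%:Z], inord `|(shift u %% M)%Z|).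
have modM (x : int) : (`|(x %% M)%Z| < M)%N.
  by rewrite -ltz_nat gez0_abs ?modz_ge0 ?ltz_pmod.
have dvdM (x : int) : (M%:Z %| x - (x %% M)%Z)%Z.
  by rewrite {1}(divz_eq x M) addrK dvdz_mull.
have := @quotient_order_le _ (residue_kernel V M) _ f.
rewrite card_prod card_ffun card_ord; apply=> u v [uv].
move=> /(congr1 (fun i : 'I_M => i%:Z)).
rewrite !inordK ?modM // !gez0_abs ?modz_ge0 // => suv.
apply/residue_kernelP; split.
  rewrite (_ : _ - _ = (shift v - (shift v %% M)%Z) -
      (shift u - (shift u %% M)%Z)).
    by rewrite rpredB.
  by rewrite suv; ring.
move=> r; pose i : 'I_M := inord `|(r %% M)%Z|.
have ri : (M%:Z %| r - i%:Z)%Z.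
  by rewrite inordK ?modM // gez0_abs ?modz_ge0.
rewrite !(rsum_congr _ ri).
by have /ffunP/(_ i) := uv; rewrite !ffunE.
Qed.

(** * Separating elements with bounded shift and support *)

Section UpperBound.
Variable V : zmodType.
Implicit Types (u v z : lamp V) (x y r s : int) (K : nat).

Definition bounded K u : Prop :=
  (`|shift u| <= K)%N /\ forall x, config u x != 0 -> (`|x| <= K)%N.

Lemma bounded1 : bounded 0 (1%g : lamp V).
Proof. by split=> // x; rewrite config1 eqxx. Qed.

Lemma bounded_le K K' u : (K <= K')%N -> bounded K u -> bounded K' u.
Proof.
move=> KK' [bu cu]; split=> [|x /cu]; last by move=> /leq_trans; apply.
exact: leq_trans KK'.
Qed.

Lemma boundedM K K' u v :
  bounded K u -> bounded K' v -> bounded (K + K')%N (u * v)%g.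
Proof.
move=> [bu cu] [bv cv]; split=> [|x]; first by rewrite shiftM; lia.
rewrite configM; have [->|/cu] := eqVneq (config u x) 0; last by lia.
by rewrite add0r => /cv; lia.
Qed.

Lemma boundedV K u : bounded K u -> bounded (2 * K)%N u^-1%g.
Proof.
move=> [bu cu]; split=> [|x]; first by rewrite shiftV; lia.
by rewrite configV oppr_eq0 => /cu; lia.
Qed.

Lemma bounded_ex u : exists K, bounded K u.
Proof.
exists (`|shift u| + \max_(x <- supp u) `|x|)%N; split=> [|x]; first by lia.
rewrite -mem_supp => /(@leq_bigmax_seq _ _ xpredT (fun x : int => `|x|%N)).
by move=> /(_ isT) xM; apply: leq_trans xM (leq_addl _ _).
Qed.

Lemma ball_bounded (S : {fset lamp V}) :
  exists K, forall n u, ball S n u -> bounded (K * n) u.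
Proof.
pose k u := projT1 (cid (bounded_ex u)).
have kP u : bounded (k u) u by rewrite /k; case: cid.
(* By [boundedV], the factor 2 also covers inverses of generators, whose supports are moved by the
   shift. *)
pose K := (2 * \max_(u <- S) k u)%N; exists K.
have SK u : u \in S -> (2 * k u <= K)%N.
  by move=> /(@leq_bigmax_seq _ _ xpredT k) /(_ isT) ku; rewrite leq_mul2l.
move=> n _ [w [wn wS ->]]; elim: w n wn wS => [|s w IHw] [|n] //=.
- by rewrite big_nil => _ _; apply: bounded_le bounded1.
- by rewrite big_nil => _ _; apply: bounded_le bounded1.
rewrite ltnS big_cons mulnS => wn /andP[sS wS].
apply: boundedM; last exact: IHw.
case/orP: sS => /SK sK; first by apply: bounded_le (kP s); lia.
by rewrite -[s]invgK; apply: bounded_le (boundedV (kP _)).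
Qed.

Lemma rsum_single m u r : (forall y, config u y != 0 ->
  (m%:Z %| y - r)%Z -> y = r) -> rsum m u r = config u r.
Proof. by apply: csum_single; rewrite subrr dvdz0. Qed.

Lemma rsum_neq0 m u r : rsum m u r != 0 ->
  exists2 y, config u y != 0 & (m%:Z %| y - r)%Z.
Proof.
apply: contra_neqP => uP; apply: csum_eq0 => y my.
by apply/eqP; apply: contra_notT uP => uy; exists y.
Qed.

(** A Laurent polynomial that vanishes modulo X^m - 1 is a multiple of it. The cofactor at x is the
    sum of u over the positions beyond x congruent to x: differences telescope, and the support is
    finite because far to the left this sum is a full residue sum. *)
Lemma rsum_eq0 m u : (0 < m)%N -> (forall r, rsum m u r = 0) ->
  exists2 h : lamp V, shift h = 0 &
    forall x, config u x = config h (x - m%:Z) - config h x.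
Proof.
move=> m0 u0; have [K [_ uK]] := bounded_ex u.
pose f x := csum (fun y => (x < y) && (m%:Z %| y - x)%Z) u.
have dvdE x y : (m%:Z %| y - (x - m%:Z))%Z = (m%:Z %| y - x)%Z.
  by rewrite opprB addrA addrAC [LHS]rpredDr ?dvdzz.
have fE x : f (x - m%:Z) = f x + config u x.
  rewrite /f /csum [LHS](bigID (fun y => x < y)) /=; congr (_ + _).
    apply: eq_bigl => y; rewrite dvdE andbAC; congr (_ && _).
    by apply/andb_idl; lia.
  apply: csum_single => [|y _ /andP[/andP[xmy]]].
    by rewrite dvdE subrr dvdz0 ltxx !andbT; lia.
  rewrite dvdE => /dvdz_small yx yx0.
  by apply/eqP; rewrite -subr_eq0 yx //; lia.
pose D := [fset i%:Z - K%:Z | i in iota 0 (2 * K).+1]%fset.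
exists (mklamp D f 0) => // x.
have configD y : config (mklamp D f 0) y = f y.
  rewrite config_mklamp; case: ifPn => // yD.
  have [Ky|yK] := leP K%:Z y.
    apply/esym/csum_eq0 => z /andP[yz _].
    by apply/eqP; apply: contraT => /uK; lia.
  have {}yK : y < - K%:Z.
    rewrite ltNge; apply: contra yD => Ky.
    apply/imfsetP; exists (absz (y + K%:Z)) => /=; last by lia.
    by rewrite inE mem_iota; lia.
  rewrite -(u0 y) /rsum /f /csum big_seq_cond [RHS]big_seq_cond.
  apply: eq_bigl => z; rewrite mem_supp.
  have [//|/uK zK] := eqVneq (config u z) 0.
  by have -> : y < z by lia.
by rewrite !configD fE addrAC subrr add0r.
Qed.


Definition translation s : lamp V := mklamp fset0 (fun=> 0) s.

Lemma config_translation s x : config (translation s) x = 0.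
Proof. by rewrite config_mklamp in_fset0. Qed.

(** Once a translation has absorbed s, the discrepancy w has shift 0 and zero residue sums, hence is
    a multiple of X^b - 1; conjugation by the cofactor h removes it. *)
Lemma conjugate_rsum u v s : shift u != 0 -> shift u = shift v ->
  (forall r, rsum `|shift u| v r = rsum `|shift u| u (r + s)) -> conjugate u v.
Proof.
set b := shift u; set m := `|b|%N => b0 uv uvE.
pose t := translation s.
pose w := (v * (u ^ t)^-1)%g.
have wE x : config w x = config v x - config u (x + s).
  rewrite configM configV shiftJ -/b -uv subrK configJ !config_translation.
  by rewrite subrr addr0.
have w0 r : rsum m w r = 0.
  rewrite rsumM rsumV shiftJ -/b -uv subrK rsumJ_dvd; last by rewrite dvdzE.
  by rewrite -uvE subrr.
have {w0} [h h0 hE] : exists2 h : lamp V, shift h = 0 &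
    forall x, config w x = config h (x - b) - config h x.
  have m0 : (0 < m)%N by rewrite absz_gt0.
  have [h h0 hE] := rsum_eq0 m0 w0.
  have [b_ge0|b_lt0] := leP 0 b.
    by exists h => // x; rewrite hE gez0_abs.
  (* For b < 0 the cofactor for X^(-b) - 1 is negated and translated to become one for X^b - 1. *)
  exists (h^-1 ^ translation b)%g => [|x].
    by rewrite shiftJ shiftV h0 oppr0.
  rewrite hE !configJ !configV !config_translation h0 ltz0_abs //.
  by rewrite !subrr !addr0 subrK opprK opprK addrC.
exists (t * h)%g; apply: lampP => [x|]; last by rewrite shiftJ.
rewrite configJ !configM !config_translation !shiftM h0 !addr0 !add0r -/b.
rewrite [x + s - b]addrAC !addrK -hE wE addrC subrK.
by [].
Qed.

Lemma conjugate_translation u v s : shift u = 0 -> shift v = 0 ->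
  (forall x, config v x = config u (x + s)) -> conjugate u v.
Proof.
move=> u0 v0 uv; exists (translation s); apply: lampP => [x|].
  by rewrite configJ !config_translation subrr addr0.
by rewrite shiftJ u0.
Qed.

Lemma separates_residue_kernel K u v : bounded K u -> bounded K v ->
  ~ conjugate u v ->
  exists2 m, (0 < m <= 6 * K + 1)%N & separates (residue_kernel V m) u v.
Proof.
move=> [bu uK] [bv vK] Nuv.
have [uv|uv] := eqVneq (shift u) (shift v); last first.
  (* The shift is a conjugacy invariant, and two shifts differ by at most 2K. *)
  exists (6 * K + 1)%N; first by lia.
  move=> /quo_conjP[z] /residue_kernelP[]; rewrite shiftJ => /dvdz_small vu _.
  by move/eqP: uv; apply; lia.
have [u0|u0] := eqVneq (shift u) 0; last first.
  exists `|shift u|%N; first by lia.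
  move=> /quo_conjP[z] /residue_kernelP[_ vE]; apply: Nuv.
  apply: (@conjugate_rsum _ _ (shift z)) => // r.
  by rewrite -vE rsumJ_dvd // dvdzE.
(* With zero shifts, conjugacy is translation. Supports lie in [-K, K], so for |r| at most 5K a
   residue sum modulo 6K + 1 meets only the position r. *)
set m := (6 * K + 1)%N; exists m; first by lia.
move=> /quo_conjP[z] /residue_kernelP[_ vE]; apply: Nuv.
have {}vE r : rsum m v r = rsum m u (r + shift z).
  by rewrite -vE rsumJ_dvd // u0 dvdz0.
have small (w : lamp V) : (forall x, config w x != 0 -> (`|x| <= K)%N) ->
    forall r, (`|r| <= 5 * K)%N -> rsum m w r = config w r.
  move=> wK r rK; apply: rsum_single => x /wK xK /dvdz_small; rewrite /m; lia.
have out (w : lamp V) : (forall x, config w x != 0 -> (`|x| <= K)%N) ->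
    forall r, (K < `|r|)%N -> config w r = 0.
  by move=> wK r rK; apply/eqP; apply: contraT => /wK; lia.
have [[i ui]|u_0] := pselect (exists i, config u i != 0); last first.
  have {}u_0 x : config u x = 0.
    by apply/eqP; apply: contra_notT u_0 => ux; exists x.
  apply: (@conjugate_translation _ _ 0) => [//||x]; first by rewrite -uv.
  rewrite u_0; have [xK|/out->//] := leqP `|x| K.
  rewrite -small ?vE //; last by lia.
  exact: csum_eq0.
have iK := uK _ ui.
have [y vy yi] : exists2 y, config v y != 0 & (m%:Z %| y - (i - shift z))%Z.
  by apply: rsum_neq0; rewrite vE subrK small //; lia.
have yK := vK _ vy.
(* Matching one lit position of u with one of v replaces [shift z] by the congruent i - y, of size
   at most 2K. For |x| at most 3K the position x + (i - y) stays within 5K; beyond that both sides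
   vanish. *)
apply: (@conjugate_translation _ _ (i - y)) => [//||x]; first by rewrite -uv.
have [xK|Kx] := leqP `|x| (3 * K); last by rewrite !out //; lia.
rewrite -!small ?vE //; [|by lia..].
apply: rsum_congr; rewrite (_ : _ - _ = y - (i - shift z)) //.
by ring.
Qed.

End UpperBound.

(** * Word balls and finite generation *)

Section Generation.
Variable G : groupType.
Implicit Types (S : {fset G}) (x y : G).

Lemma ball_le S m n x : (m <= n)%N -> ball S m x -> ball S n x.
Proof.
by move=> mn [w [wm wS ->]]; exists w; split=> //; apply: leq_trans mn.
Qed.

Lemma ballM S m n x y : ball S m x -> ball S n y -> ball S (m + n) (x * y)%g.
Proof.
move=> [w [wm wS ->]] [w' [wn wS' ->]]; exists (w ++ w').
by rewrite size_cat leq_add // all_cat wS big_cat.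
Qed.

Lemma ballV S n x : ball S n x -> ball S n x^-1%g.
Proof.
move=> [w [wn wS ->]]; elim: w n wn wS => [|s w IHw] [|n] //=.
- by move=> _ _; exists [::]; rewrite big_nil invg1.
- by move=> _ _; exists [::]; rewrite big_nil invg1.
rewrite ltnS big_cons invgM -[n.+1]addn1 => wn /andP[sS wS].
apply: ballM; first exact: IHw.
by exists [:: s^-1%g]; rewrite /= invgK andbT orbC big_seq1.
Qed.

Lemma ballX S m n x : ball S m x -> ball S (n * m) (x ^+ n)%g.
Proof.
move=> xm; elim: n => [|n IHn]; first by exists [::]; rewrite big_nil expg0.
by rewrite expgS mulSn; apply: ballM.
Qed.

Definition generated S x : Prop := exists n, ball S n x.

Lemma generatedM S x y :
  generated S x -> generated S y -> generated S (x * y)%g.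
Proof. by move=> [m xm] [n yn]; exists (m + n)%N; apply: ballM. Qed.

Lemma generatedV S x : generated S x -> generated S x^-1%g.
Proof. by move=> [n xn]; exists n; apply: ballV. Qed.

Lemma generatedJ S x y :
  generated S x -> generated S y -> generated S (x ^ y)%g.
Proof.
by move=> xS yS; apply: generatedM; [exact: generatedV | exact: generatedM].
Qed.

Lemma generated_mem S x : x \in S -> generated S x.
Proof. by move=> xS; exists 1%N, [:: x]; rewrite /= xS big_seq1. Qed.

End Generation.

Section LampGeneration.
Variable V : zmodType.
Implicit Types (u v : lamp V) (x y : int).

Lemma translationD x y :
  translation V (x + y) = (translation V x * translation V y)%g.
Proof.
by apply: lampP => // z; rewrite configM !config_translation addr0.
Qed.

Lemma translationN x : translation V (- x) = (translation V x)^-1%g.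
Proof.
by apply: lampP => // z; rewrite configV !config_translation oppr0.
Qed.

Lemma translationX (n : nat) : translation V n = (translation V 1 ^+ n)%g.
Proof.
elim: n => [|n IHn]; last by rewrite expgS -IHn -translationD.
by apply: lampP => // z; rewrite config1 config_translation.
Qed.

Definition lamp_at (c : V) : lamp V := mklamp [fset 0]%fset (fun=> c) 0.

Lemma config_lamp_at c x : config (lamp_at c) x = if x == 0 then c else 0.
Proof. by rewrite config_mklamp in_fset1. Qed.

Lemma generated_lamp (S : {fset lamp V}) :
  (forall c, lamp_at c \in S) -> translation V 1 \in S -> generates S.
Proof.
move=> cS tS u.
have trS x : generated S (translation V x).
  case: (intP x) => [|n|n].
  - rewrite -[0]/(0%:Z) translationX; exists 0%N, [::]; by rewrite big_nil.
  - have [k tk] := generated_mem tS.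
    by rewrite translationX; exists (n.+1 * k)%N; apply: ballX.
  - have [k tk] := generated_mem tS.
    rewrite translationN translationX; exists (n.+1 * k)%N.
    by apply/ballV/ballX.
(* After the shift is split off, induction on the support size removes one lamp at a time, each a
   translate of some [lamp_at c]. *)
suff gen0 n v : (#|` supp v| <= n)%N -> shift v = 0 -> generated S v.
  rewrite -[u](mulgVK (translation V (shift u))).
  apply: generatedM; last exact: trS.
  by apply: (gen0 _ _ (leqnn _)); rewrite shiftM shiftV addrN.
elim: n v => [|n IHn] v.
  rewrite leqn0 => /eqP/cardfs0_eq v0 sv.
  have -> : v = 1%g; last by exists 0%N, [::]; rewrite big_nil.
  apply: lampP => // x; rewrite config1; apply/eqP; apply: contraTT isT.
  by rewrite -mem_supp v0 in_fset0.
move=> vn sv; have [v0|[y yv]] := fset_0Vmem (supp v).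
  by apply: IHn => //; rewrite v0 cardfs0.
pose e := (lamp_at (config v y) ^ translation V (- y))%g.
have eE x : config e x = if x == y then config v y else 0.
  by rewrite configJ !config_translation subrr addr0 config_lamp_at subr_eq0.
have eS : generated S e by apply: generatedJ => //; apply: generated_mem.
rewrite -[v](mulVKg e); apply: generatedM => //.
have se : shift e = 0 by rewrite shiftJ.
apply: IHn; last by rewrite shiftM shiftV se sv.
rewrite (cardfsD1 y) yv ltnS in vn; apply: leq_trans vn.
apply/fsubset_leq_card/fsubsetP => x.
rewrite in_fsetD1 !mem_supp configM configV se shiftV se oppr0 !addr0 eE.
by have [->|_] := eqVneq x y; rewrite ?addNr ?eqxx ?oppr0 ?add0r.
Qed.

End LampGeneration.

Lemma lamp_finitely_generated (V : finZmodType) : finitely_generated (lamp V).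
Proof.
exists (translation V 1 |` [fset lamp_at c | c in V])%fset.
apply: generated_lamp => [c|]; last exact: fset1U1.
by apply/fset1Ur/imfsetP; exists c.
Qed.

(** * Conjugacy separability and the exponential upper bound *)

Section ConjUpperBound.
Variable V : finZmodType.
Implicit Types (u v : lamp V).

Lemma CD_upper K u v : bounded K u -> bounded K v -> ~ conjugate u v ->
  exists2 k, CD u v = Some k &
    (k <= #|V| ^ (6 * K + 1) * (6 * K + 1))%N.
Proof.
move=> uK vK /(separates_residue_kernel uK vK) [m /andP[m0 mK] sep].
have [fin ord] := @residue_kernel_order V m m0.
have [k -> kN] := separates_finite_CD fin sep; exists k => //.
apply: leq_trans kN (leq_trans ord _); apply: leq_mul => //.
by rewrite leq_pexp2l // (cardD1 0).
Qed.

Lemma lamp_conjugacy_separable : conjugacy_separable (lamp V).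
Proof.
move=> u v Nuv; have [K uK] := bounded_ex u; have [K' vK] := bounded_ex v.
have [|||k ->] // := @CD_upper (K + K') u v.
- by apply: bounded_le uK; rewrite leq_addr.
- by apply: bounded_le vK; rewrite leq_addl.
Qed.

Lemma Conj_upper (S : {fset lamp V}) :
  preceq (Conj S) (fun n => 2 ^ n)%N.
Proof.
have [K SK] := ball_bounded S.
(* With m = 6Kn + 1, at most (6K + 1)n, one has |V|^m m <= 2^(|V| m) 2^m <= 2^(C n). *)
pose C := ((6 * K + 1) * (#|V| + 1))%N.
exists C => [|n n0]; first by rewrite /C; lia.
apply: (@leq_trans (2 ^ (C * n))); last first.
  by rewrite leq_pmull // /C; lia.
apply/bigmax_leqP_seq => -[u v].
rewrite in_fset_set; last exact: finite_nonconjugate_pairs.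
rewrite inE => -[/= /SK uK /SK vK Nuv] _.
have [k -> /= kK] := CD_upper uK vK Nuv.
apply: leq_trans kK _; set m := (6 * _ + 1)%N.
apply: (@leq_trans ((2 ^ #|V|) ^ m * 2 ^ m)).
  apply: leq_mul; last exact/ltnW/ltn_expl.
  by rewrite leq_exp2r /m ?addn1 //; exact/ltnW/ltn_expl.
by rewrite -expnM -expnD leq_exp2l // /C /m; nia.
Qed.

End ConjUpperBound.

(** * Polynomials as configurations, and the hard pairs *)

Section PolynomialConfigurations.
Variable F : fieldType.
Implicit Types (f g h : {poly F}) (x : int) (i n : nat).

Definition lamp_poly f : lamp F :=
  mklamp [fset i%:Z | i in iota 0 (size f)]%fset (fun x => f`_(absz x)) 0.

Lemma config_lamp_poly f x :
  config (lamp_poly f) x = if 0 <= x then f`_(absz x) else 0.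
Proof.
rewrite config_mklamp; have [x0|x0] := leP 0 x; last first.
  by case: imfsetP => // -[i _ xi]; move: x0; rewrite xi.
case: ifPn => // xf; rewrite nth_default // leqNgt.
apply: contra xf => xf; apply/imfsetP; exists (absz x).
  by rewrite mem_iota.
by rewrite gez0_abs.
Qed.

Lemma lamp_polyD f g : lamp_poly (f + g) = (lamp_poly f * lamp_poly g)%g.
Proof.
apply: lampP => // x; rewrite configM !config_lamp_poly subr0.
by case: ifP; rewrite ?addr0 // coefD.
Qed.

Lemma lamp_poly0 : lamp_poly 0 = 1%g.
Proof.
apply: lampP => // x; rewrite config1 config_lamp_poly coef0.
exact: if_same.
Qed.

Lemma lamp_polyN f : lamp_poly (- f) = (lamp_poly f)^-1%g.
Proof.
by apply: (@mulgI _ (lamp_poly f)); rewrite -lamp_polyD subrr lamp_poly0 mulgV.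
Qed.

Lemma lamp_polyXnM n f :
  lamp_poly ('X^n * f) = (lamp_poly f ^ (translation F n)^-1)%g.
Proof.
rewrite -translationN; apply: lampP => [x|]; last by rewrite shiftJ.
rewrite configJ !config_translation subrr addr0 !config_lamp_poly coefXnM.
have [x0|x0] := leP 0 x; last by case: ifP => //; rewrite shift_mklamp; lia.
rewrite shift_mklamp; case: ltnP => xn; first by case: ifP => //; lia.
have -> : 0 <= x - n%:Z by lia.
by congr (_`__); lia.
Qed.

(** Every multiple of X^n - 1 can thus be inserted before t^n by conjugation, which is why
    [trace_ideal] works modulo X^b - 1. *)
Lemma translation_conj_lamp_poly n h :
  (translation F n ^ lamp_poly (- h))%g =
  (lamp_poly (- ('X^n - 1) * h) * translation F n)%g.
Proof.
rewrite mulNr mulrBl mul1r opprB lamp_polyD [in RHS]lamp_polyN lamp_polyXnM.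
rewrite /conjg !lamp_polyN !invgK !mulgA.
by rewrite !invgM !invgK !mulgA mulgVK.
Qed.

Definition allones n : {poly F} := \sum_(i < n) 'X^i.

Lemma coef_allones n i : (allones n)`_i = (i < n)%N%:R.
Proof.
rewrite coef_sum; have [i_n|n_i] := ltnP i n.
  rewrite (bigD1 (Ordinal i_n)) //= coefXn eqxx big1 ?addr0 // => j.
  by rewrite -val_eqE coefXn eq_sym /= => /negPf ->.
by rewrite big1 // => j _; rewrite coefXn gtn_eqF // (leq_trans _ n_i).
Qed.

Definition periodic_lamp n : lamp F :=
  (lamp_poly (allones n) * translation F n)%g.

(** Being an n-th power, this element has word length linear in n. *)
Lemma periodic_lampX n :
  periodic_lamp n = ((lamp_poly 1 * translation F 1) ^+ n)%g.
Proof.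
rewrite /periodic_lamp /allones; elim: n => [|n IHn].
  by rewrite big_ord0 lamp_poly0 translationX mul1g.
rewrite expgSr -IHn big_ord_recr /= lamp_polyD -['X^n]mulr1 lamp_polyXnM.
by rewrite -addn1 PoszD translationD /conjg invgK !mulgA mulgVK.
Qed.

(** All residue sums modulo n of a conjugate of t^n vanish, whereas here the class of 0 contains a
    single lit position, with value 1. *)
Lemma periodic_lamp_not_conj n : (0 < n)%N ->
  ~ conjugate (translation F n) (periodic_lamp n).
Proof.
move=> n0 [z zE]; have : rsum n (periodic_lamp n) 0 = 0.
  rewrite zE rsumJ_dvd ?dvdzz //.
  by apply: csum_eq0 => y _; rewrite config_translation.
have cE x : config (periodic_lamp n) x =
    if 0 <= x then (absz x < n)%N%:R else 0.
  by rewrite configM config_translation addr0 config_lamp_poly coef_allones.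
rewrite rsum_single => [|y].
  by rewrite cE /= n0 => /eqP; rewrite oner_eq0.
rewrite cE; case: ifP; rewrite ?eqxx // => _.
case: ltnP => [yn _|]; rewrite ?eqxx // subr0 => /dvdz_small; exact.
Qed.

End PolynomialConfigurations.

(** * The ideal cut out by a normal subgroup *)

Section Ideal.
Variables (F : fieldType) (N : normalSubgroup (lamp F)) (b : nat).
Implicit Types (f g h : {poly F}).

(* Modulo ['X^b - 1], the trace on polynomials of the subgroup [N]. *)
Definition trace_ideal f : Prop :=
  exists h, N (lamp_poly (f + ('X^b - 1) * h)).

Lemma trace_ideal_mulXb h : trace_ideal (('X^b - 1) * h).
Proof. by exists (- h); rewrite mulrN subrr lamp_poly0; exact: nsub1. Qed.

Lemma trace_ideal0 : trace_ideal 0.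
Proof. by have := trace_ideal_mulXb 0; rewrite mulr0. Qed.

Lemma trace_idealD f g :
  trace_ideal f -> trace_ideal g -> trace_ideal (f + g).
Proof.
move=> [h fh] [k gk]; exists (h + k).
by rewrite mulrDr addrACA lamp_polyD; exact: nsubM.
Qed.

Lemma trace_idealN f : trace_ideal f -> trace_ideal (- f).
Proof.
move=> [h fh]; exists (- h).
by rewrite mulrN -opprD lamp_polyN; exact: nsubV.
Qed.

Lemma trace_idealX f : trace_ideal f -> trace_ideal ('X * f).
Proof.
move=> [h fh]; exists ('X * h).
by rewrite mulrCA -mulrDr -['X]expr1 lamp_polyXnM; exact: nsubJ.
Qed.

Lemma trace_idealXsub1 n f : trace_ideal f -> trace_ideal (('X - 1) ^+ n * f).
Proof.
move=> fI; elim: n => [|n IHn]; first by rewrite mul1r.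
rewrite exprS -mulrA mulrBl mul1r.
by apply: trace_idealD; [exact: trace_idealX | exact: trace_idealN].
Qed.

(** A witness h of membership would give a conjugator taking t^b to the periodic element modulo
    N. *)
Lemma separates_trace_ideal :
  separates N (translation F b) (periodic_lamp F b) ->
  ~ trace_ideal (allones F b).
Proof.
move=> sep [h Nh]; apply: sep; apply/quo_conjP; exists (lamp_poly (- h)).
rewrite translation_conj_lamp_poly mulNr lamp_polyN /periodic_lamp.
rewrite invgM invgK -!mulgA [(_ * (_ * translation F b))%g]mulgA -lamp_polyD.
by rewrite addrC; exact: nsubJ Nh.
Qed.

(** If two distinct subset sums of powers of X - 1 agreed modulo N, multiplying their difference by
    a suitable power of X - 1 would isolate its lowest term as plus or minus (X - 1)^(b-1), all
    higher terms becoming multiples of (X - 1)^b = X^b - 1. *)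
Lemma quotient_order_trace_ideal : finite_index N ->
  ('X - 1) ^+ b = 'X^b - 1 :> {poly F} ->
  ~ trace_ideal (('X - 1) ^+ b.-1) ->
  (2 ^ b <= quotient_order N)%N.
Proof.
move=> fin frob nI.
pose P (A : {set 'I_b}) : {poly F} := \sum_(i in A) ('X - 1) ^+ i.
have <- : #|{set 'I_b}| = (2 ^ b)%N.
  by rewrite -cardsT -powersetT card_powerset cardsT card_ord.
apply: (quotient_order_ge (f := @lamp_poly F \o P)) fin => A B /=.
rewrite -lamp_polyN -lamp_polyD => NAB.
have {NAB} : trace_ideal (- P A + P B) by exists 0; rewrite mulr0 addr0.
have -> : - P A + P B = \sum_(i < b)
    ((i \in B)%:R - (i \in A)%:R) * ('X - 1) ^+ i.
  rewrite addrC /P [X in X - _]big_mkcond [X in _ - X]big_mkcond -sumrB.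
  apply: eq_bigr => i _; rewrite mulrBl.
  by congr (_ - _); case: ifP; rewrite ?mul1r ?mul0r.
move=> I_AB; apply/eqP; apply: contra_notT nI => AB.
have [i0 i0AB] : exists i, (i \in A) != (i \in B).
  apply/existsP; apply: contraNT AB; rewrite negb_exists => /forallP AB.
  by apply/eqP/setP => i; apply/eqP; have := AB i; rewrite negbK.
(* The lowest index with a nonzero coefficient; the multiplier (X - 1)^(b-1-j) raises exactly this
   term to degree b - 1. *)
case: (@arg_minnP _ i0 (fun i => (i \in A) != (i \in B)) val i0AB)
  => j jAB jmin.
have jb : (j < b)%N := ltn_ord j.
have := trace_idealXsub1 (b.-1 - j) I_AB.
rewrite mulr_sumr (bigD1 j) //= mulrCA -exprD subnK; last by lia.
set e := (_ - _) * _; set rest := (\sum_(_ < _ | _) _).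
move=> I_e; have {I_e} : trace_ideal e.
  rewrite -[e](addrK rest); apply: trace_idealD => //; apply: trace_idealN.
  apply: (big_ind trace_ideal); [exact: trace_ideal0|exact: trace_idealD|].
  move=> i ij; rewrite mulrCA -exprD.
  have [iAB|/jmin ji] := eqVneq (i \in A) (i \in B).
    by rewrite iAB subrr mul0r; exact: trace_ideal0.
  have {}ji : (j < i)%N by rewrite ltn_neqAle ji andbT eq_sym.
  have -> : (b.-1 - j + i = b + (i - j.+1))%N by lia.
  by rewrite exprD frob mulrCA; exact: trace_ideal_mulXb.
move: jAB; rewrite /e; case: (j \in A); case: (j \in B) => // _.
  by rewrite sub0r mulN1r => /trace_idealN; rewrite opprK.
by rewrite subr0 mul1r.
Qed.

End Ideal.

(** * Frobenius and the exponential lower bound *)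

Section LowerBound.
Variables (F : fieldType) (p : nat).
Hypothesis charF : p \in [pchar F].

Lemma Xsub1_pchar_exp k :
  ('X - 1) ^+ (p ^ k) = 'X^(p ^ k) - 1 :> {poly F}.
Proof.
have p_nat : [pchar {poly F}].-nat (p ^ k)%N.
  rewrite pnatX; apply/orP; left; rewrite pnatE ?(pcharf_prime charF) //.
  by rewrite pchar_poly.
by rewrite exprDn_pchar // exprNn_pchar // expr1n.
Qed.

(** Cancel X - 1 in X^b - 1 = (X - 1)^b, where b = p^k. *)
Lemma allones_pchar_exp k :
  allones F (p ^ k) = ('X - 1) ^+ (p ^ k).-1.
Proof.
have p0 : (0 < p ^ k)%N by rewrite expn_gt0 (prime_gt0 (pcharf_prime charF)).
apply: (mulfI (x := 'X - 1)); first by rewrite polyXsubC_eq0.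
by rewrite -subrX1 -exprS prednK // Xsub1_pchar_exp.
Qed.

Lemma CD_lower k m :
  CD (translation F (p ^ k)%N) (periodic_lamp F (p ^ k)) = Some m ->
  (2 ^ (p ^ k) <= m)%N.
Proof.
rewrite /CD; case: pselect => // ex [<-].
case: ex_minnP => {ex} _ /asboolP[N [fin sep <-]] _.
apply: quotient_order_trace_ideal => //; first exact: Xsub1_pchar_exp.
rewrite -allones_pchar_exp; exact: separates_trace_ideal.
Qed.

Lemma Conj_lower (S : {fset lamp F}) :
  conjugacy_separable (lamp F) -> generates S ->
  preceq (fun n => 2 ^ n)%N (Conj S).
Proof.
move=> cs gen; have [c1 ac] := gen (lamp_poly 1).
have [c2 tc] := gen (translation F 1).
pose c := (c1 + c2)%N; have p1 := prime_gt1 (pcharf_prime charF).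
(* Both elements are b-th powers of elements of length at most c, and b <= p n, so they lie in the
   ball of radius C n. *)
pose C := (c * p).+1; exists C => // n n0.
pose k := up_log p n; pose b := (p ^ k)%N.
have nb : (n <= b)%N by exact: up_logP.
have bn : (b <= p * n)%N.
  have [n1|n1] := ltnP 1 n; last first.
    have nE : n = 1%N by lia.
    by rewrite /b /k nE up_log1 muln1 ltnW.
  have /andP[kn _] := up_log_bounds p1 n1.
  have k0 : (0 < k)%N by rewrite /k up_log_gt0 p1.
  by rewrite /b -(prednK k0) expnS leq_mul // ltnW.
have b0 : (0 < b)%N by exact: leq_trans nb.
have Nconj := periodic_lamp_not_conj (F := F) b0.
(* Conjugacy separability ensures that this pair does not contribute the default 0 to the
   maximum. *)
have [m CDm] : exists m, CD (translation F b) (periodic_lamp F b) = Some m.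
  by case: CD (cs _ _ Nconj) => // m _; exists m.
apply: (@leq_trans m).
  by apply: leq_trans (CD_lower CDm); rewrite leq_exp2l.
apply: leq_trans (leq_pmull _ _) => //; rewrite /Conj.
have Cb : (b * c <= C * n)%N by rewrite /C; nia.
have := @leq_bigmax_seq _ (enum_fset (fset_set (nonconjugate_pairs S (C * n))))
  xpredT (fun q => odflt 0%N (CD q.1 q.2)) (translation F b, periodic_lamp F b).
rewrite /= CDm /=; apply=> //.
rewrite in_fset_set ?inE; last exact: finite_nonconjugate_pairs.
split=> //=.
  apply: ball_le Cb _; rewrite translationX; apply/ballX/ball_le/tc.
  exact: leq_addl.
by apply: ball_le Cb _; rewrite periodic_lampX; apply/ballX/ballM.
Qed.

End LowerBound.

Theorem corollary1p2 (F : finFieldType) :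
  let G := wreath (Algebra.to_multiplicative F) (Algebra.to_multiplicative int) in
  [/\ finitely_generated G,
      conjugacy_separable G
    & forall S : {fset G},
        generates S -> growth_equiv (Conj S) (fun n : nat => (2 ^ n)%N)].
Proof.
split; [exact: lamp_finitely_generated | exact: lamp_conjugacy_separable |].
move=> S gen; split; first exact: Conj_upper.
have [p _ charF] := finPcharP F.
exact: (Conj_lower charF (@lamp_conjugacy_separable F) gen).
Qed.
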